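(* Let $(G,\alpha)$ be a contractible group and let $G(\alpha)=(G,\circ,\bullet)$ be the associated uniform irq. Then this irq is distributive, namely it satisfies, for all $x,y,z\in G$, the relation $$x\circ(y\circ z)=(x\circ y)\circ(x\circ z).$$ Conversely, let $(G,\circ,\bullet)$ be a distributive uniform irq. Then there is a group operation on $G$ (denoted multiplicatively), with neutral element $e$, such that: \begin{enumerate} \item[(i)] $xy = x +^{e}_{\infty} y$ for any $x,y\in G$; \item[(ii)] $(xyz)_{\infty} = x y^{-1} z$ for any $x,y,z\in G$; \item[(iii)] $x\circ y = x\,\big(e\circ(x^{-1}y)\big)$ for any $x,y\in G$. \end{enumerate} In conclusion, there is a bijection between distributive uniform irqs and contractible groups.
   Context: An idempotent right quasigroup (irq) $(X,\circ,\bullet)$ is a set $X$ with two binary operations such that for all $x,y\in X$: $x\circ(x\bullet y)=x\bullet(x\circ y)=y$ and $x\circ x=x\bullet x=x$. It is distributive if $x\circ(y\circ z)=(x\circ y)\circ(x\circ z)$ for all $x,y,z\in X$. For integers $k\ge1$: $x\circ_1u=x\circ u$, $x\bullet_1u=x\bullet u$, $x\circ_{k+1}u=x\circ(x\circ_k u)$, $x\bullet_{k+1}u=x\bullet(x\bullet_k u)$. Define $$v -^{x}_{k} u := (xuv)_k := (x\circ_k u)\bullet_k(x\circ_k v),\qquad u +^{x}_{k} v := x\bullet_k\big((x\circ_k u)\circ_k v\big).$$ A uniform irq $(X,\circ,\bullet)$ is a separable uniform space $X$ endowed with continuous irq operations $\circ,\bullet$ such that: (1) $\circ$ is compactly contractive: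 for each $x\in X$, each compact set $K\subset X$ and each open set $U\subset X$ with $x\in U$, there is $N(K,U)\in\mathbb{N}$ such that $x\circ_n u\in U$ for all $u\in K$ and all $n\in\mathbb{N}$, $n\ge N(K,U)$; (2) the limits $v -^{x}_{\infty} u := (xuv)_\infty := \lim_{k\to\infty} (xuv)_k$ and $u +^{x}_{\infty} v := \lim_{k\to\infty} u +^{x}_{k} v$ exist and are uniform with respect to $x,u,v$ in a compact set. A contractible group is a pair $(G,\alpha)$, where $G$ is a topological group with neutral element denoted by $e$ and $\alpha\in\mathrm{Aut}(G)$ is an automorphism of $G$, continuous with continuous inverse, such that $\lim_{n\to\infty}\alpha^n(x)=e$ for every $x\in G$. The irq $G(\alpha)$ associated to $(G,\alpha)$ is $(G,\circ,\bullet)$ with $x\circ u = x\,\alpha(x^{-1}u)$ and $x\bullet u = x\,\alpha^{-1}(x^{-1}u)$; it is taken as known that $G(\alpha)$ is a uniform irq.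
   Formalization: The bijection, false in general, is proved on each uniform space with a fixed point e, between contractible groups whose G(α) is a uniform irq and distributive uniform irqs whose (xyz)_∞ is jointly continuous; on locally compact Hausdorff spaces it is proved with neither restriction. *)

(* Defs.v *)
From mathcomp Require Import all_boot all_order.
From mathcomp Require Import mathcomp_extra boolp classical_sets functions.
From mathcomp Require Import topology.

Set Implicit Arguments.
Unset Strict Implicit.
Unset Printing Implicit Defensive.

Local Open Scope classical_set_scope.

Record irq_ops (X : Type) := IrqOps {
  circ : X -> X -> X;
  bull : X -> X -> X }.

Section Irq.
Variables (X : Type) (Q : irq_ops X).

Definition is_irq : Prop := forall x y : X,
  [/\ circ Q x (bull Q x y) = y, bull Q x (circ Q x y) = y,
      circ Q x x = x & bull Q x x = x].

Definition irq_distributive : Prop := forall x y z : X,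
  circ Q x (circ Q y z) = circ Q (circ Q x y) (circ Q x z).

Definition circ_n (k : nat) (x u : X) : X := iter k (circ Q x) u.

Definition bull_n (k : nat) (x u : X) : X := iter k (bull Q x) u.

(* (x u v)_k, also written v -^x_k u *)
Definition irq_diff (k : nat) (x u v : X) : X :=
  bull_n k (circ_n k x u) (circ_n k x v).

(* u +^x_k v *)
Definition irq_sum (k : nat) (x u v : X) : X :=
  bull_n k x (circ_n k (circ_n k x u) v).

End Irq.

Section UniformIrq.
Variables (X : uniformType) (Q : irq_ops X).

(* These are the library's [lim], except that the junk value used when there is
   no limit is x rather than the default point of a pointed type. *)
Definition irq_diff_lim (x u v : X) : X :=
  xget x [set l | (fun k => irq_diff Q k x u v) @ \oo --> l].

Definition irq_sum_lim (x u v : X) : X :=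
  xget x [set l | (fun k => irq_sum Q k x u v) @ \oo --> l].

Definition compactly_contractive : Prop :=
  forall (x : X) (K U : set X), compact K -> open U -> U x ->
    exists N : nat, forall n : nat, (N <= n)%N ->
      forall u : X, K u -> U (circ_n Q n x u).

(* The limit of the maps f k exists pointwise, and the convergence is uniform
   when the three arguments range over a compact set. *)
Definition compactly_uniform_limit (f : nat -> X -> X -> X -> X)
    (g : X -> X -> X -> X) : Prop :=
  (forall x u v : X, (fun k => f k x u v) @ \oo --> g x u v) /\
  (forall K : set X, compact K ->
    {uniform K `*` K `*` K,
      (fun k (p : X * X * X) => f k p.1.1 p.1.2 p.2) @ \oo -->
      (fun p : X * X * X => g p.1.1 p.1.2 p.2)}).

(* "Separable" means separated, that is Hausdorff. *)
Definition uniform_irq : Prop :=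
  [/\ hausdorff_space X,
      is_irq Q,
      continuous (fun p : X * X => circ Q p.1 p.2) /\
      continuous (fun p : X * X => bull Q p.1 p.2),
      compactly_contractive &
      compactly_uniform_limit (irq_diff Q) irq_diff_lim /\
      compactly_uniform_limit (irq_sum Q) irq_sum_lim].

Definition distributive_uniform_irq : Prop :=
  uniform_irq /\ irq_distributive Q.

End UniformIrq.

Definition is_group (G : Type) (mul : G -> G -> G) (e : G) (inv : G -> G) :
    Prop :=
  [/\ associative mul, left_id e mul, right_id e mul,
      left_inverse e inv mul & right_inverse e inv mul].

(* A multiplication and a self-map of G, together with the inversion and the
   inverse map, which they determine. *)
Record group_aut (G : Type) := GroupAut {
  gmul : G -> G -> G;
  ginv : G -> G;
  gaut : G -> G;
  gautV : G -> G }.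

Definition contractible_group (G : topologicalType) (e : G)
    (A : group_aut G) : Prop :=
  [/\ is_group (gmul A) e (ginv A),
      continuous (fun p : G * G => gmul A p.1 p.2) /\ continuous (ginv A),
      [/\ {morph gaut A : x y / gmul A x y >-> gmul A x y},
          cancel (gaut A) (gautV A) & cancel (gautV A) (gaut A)],
      continuous (gaut A) /\ continuous (gautV A) &
      forall x : G, (fun n => iter n (gaut A) x) @ \oo --> e].

Definition irq_of_group (G : Type) (A : group_aut G) : irq_ops G :=
  IrqOps (fun x u => gmul A x (gaut A (gmul A (ginv A x) u)))
         (fun x u => gmul A x (gautV A (gmul A (ginv A x) u))).

(* Main.v *)
Require Import Defs.
From mathcomp Require Import all_boot all_order.
From mathcomp Require Import mathcomp_extra boolp classical_sets functions.
From mathcomp Require Import topology.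

(** The iterated difference and sum of a distributive irq are the same
    operation: each map x o_k _ is then an automorphism of the whole structure,
    so that
      (x u v)_k = x o_k (u b_k v)   and   u +^x_k v = (u x v)_k,
    where o and b are the two operations. Write T x u v for the limit of
    (x u v)_k. The identities at level k pass to the limit and make T an
    associative Mal'cev operation, that is a torsor:
      T x x v = v,   T x u u = x,   T x y (T y w z) = T x w z,
      T x y (T z y w) = T (T x y z) y w.
    Fixing a base point e in a torsor gives a group, with product T x e y and
    inverse T e x e, in which T x y z is x y^-1 z ([heap_group],
    [heap_group_div]).

    In the last two identities the inner terms vary with k before the limit is
    taken, and in the last one even a base point does: that identity is the
    limit of the exact relation [irq_sumA], where the inner sum is based at
    x o_k u, a point that converges to x. Uniformity of the limit on compact
    sets takes care of this, the compact set being made of convergent sequences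
    together with their limits ([cvg_irq_diff_seq]). The formula
      x o y = x (e o (x^-1 y))
    comes from the level k identity
      (x, e o x, e o y)_k = (x o_k e) o y,
    whose right hand side tends to x o y.

    Conversely, in a contractible group
      (x u v)_k = x alpha^k(x^-1 u) u^-1 v,
    which tends to x u^-1 v. So the group is recovered from the irq and the
    choice of e ([irq_of_groupK]), and the irq from the group
    ([group_of_irqK]). For the group produced by an irq to be topological, T
    has to be jointly continuous.

    When the space is locally compact, this continuity is automatic, and so is
    the uniformity of the irq of a contractible group. For the former, a limit
    that is uniform on compact sets is continuous
    ([locally_compact_irq_diff_lim]). For the latter, Baire's theorem shows
    that alpha^k tends to e uniformly near e ([contraction_locally_uniform]),
    hence near every point by translation; then all the convergences are
    locally uniform, hence uniform on compact sets
    ([locally_compact_uniform_irq]). *)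

Set Implicit Arguments.
Unset Strict Implicit.
Unset Printing Implicit Defensive.

Local Open Scope classical_set_scope.

(** * Convergence and uniform limits on compact sets *)

Lemma cvg_triple (I : Type) (F : set_system I) (X : topologicalType)
    (x_ u_ v_ : I -> X) (x u v : X) {FF : Filter F} :
  x_ i @[i --> F] --> x -> u_ i @[i --> F] --> u -> v_ i @[i --> F] --> v ->
  (x_ i, u_ i, v_ i) @[i --> F] --> (x, u, v).
Proof. by move=> xx uu vv; exact: cvg_pair (cvg_pair xx uu) vv. Qed.

Lemma cvg_op2 (I : Type) (F : set_system I) (X Y Z : topologicalType)
    (h : X -> Y -> Z) (f : I -> X) (g : I -> Y) (x : X) (y : Y)
    {FF : Filter F} :
  continuous (fun p : X * Y => h p.1 p.2) ->
  f i @[i --> F] --> x -> g i @[i --> F] --> y ->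
  h (f i) (g i) @[i --> F] --> h x y.
Proof. by move=> hc; apply: continuous2_cvg; exact: (hc (x, y)). Qed.

Lemma cvg_triple1 (X : topologicalType) (x u v : X) :
  p.1.1 @[p --> (x, u, v)] --> x.
Proof. exact: (@cvg_comp _ _ _ fst fst _ (nbhs (x, u)) _ cvg_fst cvg_fst). Qed.

Lemma cvg_triple2 (X : topologicalType) (x u v : X) :
  p.1.2 @[p --> (x, u, v)] --> u.
Proof. exact: (@cvg_comp _ _ _ fst snd _ (nbhs (x, u)) _ cvg_fst cvg_snd). Qed.

Lemma continuous_iter2 (X : topologicalType) (h : X -> X -> X) (n : nat) :
  continuous (fun p : X * X => h p.1 p.2) ->
  continuous (fun p : X * X => iter n (h p.1) p.2).
Proof.
move=> hc [x y]; elim: n => [|n IH] /=; first exact: cvg_snd.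
exact: (cvg_op2 hc cvg_fst IH).
Qed.

Lemma nbhs_triple (X : topologicalType) (A : set X) (x u v : X) :
  nbhs x A -> nbhs u A -> nbhs v A -> nbhs (x, u, v) (A `*` A `*` A).
Proof.
move=> Ax Au Av; exists (A `*` A, A) => //=.
by split=> //; exists (A, A).
Qed.

Lemma compact_cvg_range (T : topologicalType) (a : nat -> T) (p : T) :
  a @ \oo --> p -> compact (range a `|` [set p]).
Proof.
move=> acvg; apply/compact_near_coveringP => I F P FF cov.
have [[U V] [/= Up FV] UV] := cov p (or_intror erefl).
have [N _ aU] := acvg U Up.
have head : \forall i \near F, forall n, (n < N)%N -> P i (a n).
  elim: {aU} N => [|N IH]; first exact: nearW.
  have : range a (a N) by exists N.
  move=> /(@or_introl _ (a N = p)) /cov [[U' V'] [/= U'a FV'] UV'].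
  near=> i => n; rewrite ltnS leq_eqVlt => /predU1P[->|].
    apply: (UV' (a N, i)); split; first exact: nbhs_singleton.
    by near: i; exact: FV'.
  by move: n; near: i; exact: IH.
near=> i => x [[n _ <-]|->]; last first.
  by apply: (UV (p, i)); split; [exact: nbhs_singleton|near: i; exact: FV].
have [nN|Nn] := ltnP n N; first by move: n nN; near: i; exact: head.
by apply: (UV (a n, i)); split=> /=; [exact: aU|near: i; exact: FV].
Unshelve. all: by end_near. Qed.

Section UniformLimits.
Context {T : topologicalType} {V : uniformType}.
Variables (f : nat -> T -> V) (g : T -> V) (K : set T).

Lemma uniform_cvg_entourageP :
  {uniform K, f @ \oo --> g} <->
  forall E, entourage E -> \forall n \near \oo, forall y, K y -> E (g y, f n y).
Proof.
split=> [cvf E entE|cvf P /uniform_nbhs [E [entE EP]]].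
  by apply: (cvf [set h | forall y, K y -> E (g y, h y)]);
     apply/uniform_nbhs; exists E; split.
by near=> n; apply: EP; near: n; exact: cvf.
Unshelve. all: by end_near. Qed.

Lemma uniform_limit_within p : (forall n, continuous (f n)) ->
  {uniform K, f @ \oo --> g} -> K p -> g @ within K (nbhs p) --> g p.
Proof.
move=> fc /uniform_cvg_entourageP cvf Kp.
apply/cvg_app_entourageP => E entE.
pose D := split_ent E.
have entD : entourage D by exact: entourage_split_ent.
pose D' := split_ent D.
have entD' : entourage D' by exact: entourage_split_ent.
have [N _ /(_ N (leqnn N)) fN] := cvf _ (entourage_invI entD').
have /cvg_app_entourageP/(_ D' entD') fNc := fc N p.
rewrite near_withinE; near=> q => Kq.
apply: (@entourage_split _ (f N q)) => //.
  apply: (@entourage_split _ (f N p)) => //; first by have [] := fN p Kp.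
  by near: q.
apply: split_ent_subset => //.
by have [] := fN q Kq.
Unshelve. all: by end_near. Qed.

(** A uniform limit of continuous functions may be evaluated along moving
    points: [f n q] tends to [g p] when [n] grows and [q] tends to [p] inside
    [K] simultaneously. *)
Lemma uniform_limit_joint p : (forall n, continuous (f n)) ->
  {uniform K, f @ \oo --> g} -> K p ->
  f q.1 q.2 @[q --> filter_prod \oo (within K (nbhs p))] --> g p.
Proof.
move=> fc cvf Kp; apply/cvg_app_entourageP => E entE.
have entD : entourage (split_ent E) by exact: entourage_split_ent.
have /cvg_app_entourageP/(_ _ entD) gc := uniform_limit_within fc cvf Kp.
have /uniform_cvg_entourageP/(_ _ entD) fg := cvf.
exists ([set n | forall y, K y -> split_ent E (g y, f n y)],
        [set q | K q /\ split_ent E (g p, g q)]) => /=.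
  split=> //.
  move: gc; rewrite near_withinE; apply: filterS => q gq Kq.
  by split; [|exact: gq].
move=> [n q] /= [fn [Kq gq]].
by apply: (@entourage_split _ (g q)) => //; exact: fn.
Qed.

(** A convergence that is joint in the index and the point is locally uniform,
    because the limit is continuous; compactness, in the form of near coverings,
    makes it uniform. *)
Lemma joint_limit_uniform : compact K ->
  (forall p, K p -> {for p, continuous g}) ->
  (forall p, K p -> f q.1 q.2 @[q --> filter_prod \oo (nbhs p)] --> g p) ->
  {uniform K, f @ \oo --> g}.
Proof.
move=> /compact_near_coveringP Kc gc fg; apply/uniform_cvg_entourageP => E entE.
apply: (Kc _ \oo (fun n y => E (g y, f n y))) => p Kp.
have entD : entourage (split_ent E) by exact: entourage_split_ent.
have /cvg_app_entourageP/(_ _ (entourage_inv entD)) gp := gc p Kp.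
have /cvg_app_entourageP/(_ _ entD)[[A B] [/= Aoo Bp] AB] := fg p Kp.
exists (B `&` [set q | (split_ent E)^-1%relation (g p, g q)], A) => /=.
  by split=> //; exact: filterI.
move=> [q n] /= [[Bq gq] An].
by apply: (@entourage_split _ (g p)) => //; exact: (AB (n, q)).
Qed.

End UniformLimits.

(** [l] stands for the limit chosen by [irq_diff_lim] or [irq_sum_lim], and [g]
    for an explicit formula of the limit. *)
Lemma joint_compactly_uniform (X : uniformType)
    (f : nat -> X -> X -> X -> X) (g l : X -> X -> X -> X) :
  (forall x u v, l x u v = g x u v) ->
  continuous (fun p : X * X * X => g p.1.1 p.1.2 p.2) ->
  (forall p : X * X * X,
    f q.1 q.2.1.1 q.2.1.2 q.2.2 @[q --> filter_prod \oo (nbhs p)] -->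
    g p.1.1 p.1.2 p.2) ->
  compactly_uniform_limit f l.
Proof.
move=> lg gC fg.
have -> : l = g by apply/funext => x; apply/funext => u; exact/funext.
split=> [x u v|K cK].
  have diag : (k, (x, u, v)) @[k --> \oo] -->
      filter_prod \oo (nbhs (x, u, v)).
    by apply: (@cvg_pair _ _ _ \oo \oo (nbhs (x, u, v)));
      [exact: cvg_id|exact: cvg_cst].
  exact: (cvg_comp _ _ diag (fg (x, u, v))).
apply: joint_limit_uniform => [|p _|p _]; [|exact: gC|exact: fg].
by apply: compact_setX => //; exact: compact_setX.
Qed.

(** * Baire's theorem in locally compact regular spaces *)

(** If every [C n] had empty interior, one could choose closed sets with
    nonempty interior [V n.+1] inside [V n] and disjoint from [C n], by
    regularity. Starting from a compact [V 0], they have a common point, which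
    is in no [C n]. *)
Lemma locally_compact_baire (T : topologicalType) (C : nat -> set T) (t : T) :
  regular_space T -> locally_compact [set: T] ->
  (forall n, closed (C n)) -> \bigcup_n C n = setT ->
  exists n, (C n)° !=set0.
Proof.
move=> regT lcT clC covC; apply: contrapT => /forallNP noC.
have step (nV : nat * set T) : exists W : set T,
    nV.2° !=set0 -> [/\ closed W, W° !=set0 & W `<=` nV.2 `\` C nV.1].
  have [[y Vy]|V0] := pselect (nV.2° !=set0); last by exists set0 => /V0.
  have [z [Vz Cz]] : exists z, nV.2° z /\ ~ C nV.1 z.
    apply: contrapT => noz; apply: (noC nV.1); exists y.
    apply: filterS (open_nbhs_nbhs (conj (@open_interior _ nV.2) Vy)) => z Vz.
    by apply: contrapT => Cz; apply: noz; exists z.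
  have /regT[W Wz clW] : nbhs z (nV.2 `\` C nV.1).
    apply: filterI => //; apply: open_nbhs_nbhs; split=> //.
    by rewrite openC; exact: clC.
  exists (closure W) => _; split=> //; first exact: closed_closure.
  by exists z; apply: filterS Wz; exact: subset_closure.
(* Only the values of [f] at sets with nonempty interior matter; the others are
   junk. *)
have [f fP] := choice step.
have [V0 + [cV0 clV0]] := lcT t I; rewrite withinET => V0t.
pose V := fix V n := if n is m.+1 then f (m, V m) else V0.
have VI n : (V n)° !=set0.
  by elim: n => [|n IH]; [exists t|have [] := fP (n, V n) IH].
have clV n : closed (V n) by case: n => [//|n]; have [] := fP (n, V n) (VI n).
have VS n : V n.+1 `<=` V n `\` C n by have [] := fP (n, V n) (VI n).
have Vle m n : (m <= n)%N -> V n `<=` V m.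
  elim: n => [|n IH]; first by rewrite leqn0 => /eqP ->.
  rewrite leq_eqVlt => /predU1P[-> //|/IH VV x /VS[Vx _]]; exact: VV.
have [a aV] : {a : nat -> T & forall n, V n (a n)}.
  apply: (@choice _ _ V) => n.
  by have [x /interior_subset] := VI n; exists x.
have [p [_ ap]] : V0 `&` cluster (a @ \oo) !=set0.
  by apply: cV0; exists 0%N => // n n0; exact: Vle n0 _ (aV n).
have Vp n : V n p.
  apply: clV => B; apply: ap.
  by exists n => // m nm; exact: Vle nm _ (aV m).
have [n _ Cp] : (\bigcup_n C n) p by rewrite covC.
by have [_] := VS n p (Vp n.+1).
Qed.

(** * Identities in an irq *)

Lemma irq_ops_eq (X : Type) (P Q : irq_ops X) :
  circ P =2 circ Q -> bull P =2 bull Q -> P = Q.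
Proof.
case: P Q => c b [c' b'] /= cc' bb'.
by congr IrqOps; apply/funext => x; apply/funext.
Qed.

Section IrqAlgebra.
Context {X : Type} {Q : irq_ops X}.
Implicit Types (x y z u v w : X) (h : X -> X) (k m n : nat).

Section Irq.
Hypothesis irqQ : is_irq Q.

Let circK x y : circ Q x (bull Q x y) = y.
Proof. by have [] := irqQ x y. Qed.

Let bullK x y : bull Q x (circ Q x y) = y.
Proof. by have [] := irqQ x y. Qed.

Lemma circ_nK n x : cancel (circ_n Q n x) (bull_n Q n x).
Proof. by move=> u; elim: n => [//|n IH]; rewrite /bull_n iterSr /= bullK. Qed.

Lemma bull_nK n x : cancel (bull_n Q n x) (circ_n Q n x).
Proof. by move=> u; elim: n => [//|n IH]; rewrite /circ_n iterSr /= circK. Qed.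

Lemma circ_nxx n x : circ_n Q n x x = x.
Proof. by apply: iter_fix; have [] := irqQ x x. Qed.

Lemma bull_nxx n x : bull_n Q n x x = x.
Proof. by apply: iter_fix; have [] := irqQ x x. Qed.

(** Associativity of the sum at a finite level, up to a displacement of the base
    point of the inner sum from [x] to [circ_n Q k x u]. *)
Lemma irq_sumA k x u v w :
  irq_sum Q k x u (irq_sum Q k (circ_n Q k x u) v w) =
  irq_sum Q k x (irq_sum Q k x u v) w.
Proof. by rewrite /irq_sum !bull_nK. Qed.

Lemma circ_n_morph h n : {morph h : x y / circ Q x y} ->
  {morph h : x y / circ_n Q n x y}.
Proof. by move=> hD x y; elim: n => [//|n IH] /=; rewrite hD IH. Qed.

(** [bull] is determined by [circ], so that an endomorphism for [circ] is one
    for every operation derived from it. *)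
Lemma bull_n_morph h n : {morph h : x y / circ Q x y} ->
  {morph h : x y / bull_n Q n x y}.
Proof.
move=> hD x y; apply: (can_inj (circ_nK n (h x))).
by rewrite -(circ_n_morph n hD) !bull_nK.
Qed.

Lemma irq_diff_morph h k : {morph h : x y / circ Q x y} ->
  forall x u v, h (irq_diff Q k x u v) = irq_diff Q k (h x) (h u) (h v).
Proof.
move=> hD x u v; rewrite /irq_diff.
by rewrite (bull_n_morph k hD) !(circ_n_morph k hD).
Qed.

Hypothesis distrQ : irq_distributive Q.

Lemma circ_nD n x : {morph circ_n Q n x : y z / circ Q y z}.
Proof. by move=> y z; elim: n => [//|n IH] /=; rewrite IH distrQ. Qed.

Lemma bull_nD n x : {morph bull_n Q n x : y z / circ Q y z}.
Proof.
by move=> y z; apply: (can_inj (circ_nK n x)); rewrite circ_nD !bull_nK.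
Qed.

Lemma irq_diffE k x u v : irq_diff Q k x u v = circ_n Q k x (bull_n Q k u v).
Proof. by rewrite (bull_n_morph k (circ_nD k x)). Qed.

Lemma irq_sumE k x u v : irq_sum Q k x u v = irq_diff Q k u x v.
Proof.
by rewrite /irq_sum (circ_n_morph k (bull_nD k x)) circ_nK irq_diffE.
Qed.

Lemma irq_diff_chain k x y w z :
  irq_diff Q k x y (irq_diff Q k y w z) = irq_diff Q k x w z.
Proof. by rewrite !irq_diffE circ_nK. Qed.

(** Applying [circ Q e] to the last two arguments commutes with [bull_n], and
    [circ_n Q k x] then carries the result to [circ Q (circ_n Q k x e) y]. *)
Lemma irq_diff_circ k e x y :
  irq_diff Q k x (circ Q e x) (circ Q e y) = circ Q (circ_n Q k x e) y.
Proof.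
have eD : {morph circ Q e : u v / circ Q u v} by exact: distrQ.
by rewrite irq_diffE -bull_n_morph// circ_nD bull_nK.
Qed.

End Irq.
End IrqAlgebra.

(** * The group of a pointed heap *)

(** The model of [T x y z] is the ternary operation x y^-1 z of a group. The
    four hypotheses are those identities of it that come directly from an irq;
    the last one is the associativity of the product with base point [y]. *)
Section HeapGroup.
Variables (X : Type) (T : X -> X -> X -> X).
Hypothesis heap_left : forall x y, T x x y = y.
Hypothesis heap_right : forall x y, T x y y = x.
Hypothesis heap_chain : forall x y w z, T x y (T y w z) = T x w z.
Hypothesis heap_assoc : forall x y z w, T x y (T z y w) = T (T x y z) y w.
Variable e : X.

Lemma heap_group : is_group (fun x y => T x e y) e (fun x => T e x e).
Proof.
have Vr x : T x e (T e x e) = e by rewrite heap_chain heap_left.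
(* A right inverse in a monoid where all elements have one is a left inverse:
   y x = y x (y z) = y (x y) z = y z = e. *)
split=> // x; set y := T e x e; set z := T e y e.
have : T (T y e x) e (T y e z) = T y e (T (T x e y) e z).
  by rewrite -!heap_assoc.
by rewrite !Vr heap_left heap_right Vr.
Qed.

Lemma heap_div y z : T (T e y e) e z = T e y z.
Proof.
have [_ _ _ lV _] := heap_group.
have {lV} yVy : T (T e y e) e y = e := lV y.
by rewrite -[in LHS](heap_left y z) -(heap_chain y e) heap_assoc yVy heap_left.
Qed.

Lemma heap_group_div x y z : T x y z = T (T x e (T e y e)) e z.
Proof. by rewrite -heap_assoc heap_div heap_chain. Qed.

End HeapGroup.

(** * Limits in a uniform irq *)

Lemma irq_diff_lim_unique (X : uniformType) (Q : irq_ops X) (x u v l : X) :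
  hausdorff_space X -> irq_diff Q k x u v @[k --> \oo] --> l ->
  irq_diff_lim Q x u v = l.
Proof. by move=> hausX lP; apply: (xget_subset1 x lP); exact: cvg_unique. Qed.

Lemma irq_sum_lim_unique (X : uniformType) (Q : irq_ops X) (x u v l : X) :
  hausdorff_space X -> irq_sum Q k x u v @[k --> \oo] --> l ->
  irq_sum_lim Q x u v = l.
Proof. by move=> hausX lP; apply: (xget_subset1 x lP); exact: cvg_unique. Qed.

Section UniformIrq.
Context {X : uniformType} {Q : irq_ops X}.
Hypothesis uQ : uniform_irq Q.

Let hausX : hausdorff_space X. Proof. by case: uQ. Qed.
Let irqQ : is_irq Q. Proof. by case: uQ. Qed.

Lemma circ_continuousr x : continuous (circ Q x).
Proof.
have [_ _ [circC _] _ _] := uQ.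
by move=> u; exact: (cvg_op2 circC (cvg_cst _) cvg_id).
Qed.

Lemma circ_n_continuous n : continuous (fun p : X * X => circ_n Q n p.1 p.2).
Proof. by apply: continuous_iter2; have [_ _ []] := uQ. Qed.

Lemma bull_n_continuous n : continuous (fun p : X * X => bull_n Q n p.1 p.2).
Proof. by apply: continuous_iter2; have [_ _ []] := uQ. Qed.

Lemma irq_diff_continuous k :
  continuous (fun p : X * X * X => irq_diff Q k p.1.1 p.1.2 p.2).
Proof.
move=> [[x u] v] /=; rewrite /irq_diff.
have circ_c := @circ_n_continuous k.
apply: (cvg_op2 (@bull_n_continuous k)).
  exact: (cvg_op2 circ_c (@cvg_triple1 _ x u v) (@cvg_triple2 _ x u v)).
exact: (cvg_op2 circ_c (@cvg_triple1 _ x u v) cvg_snd).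
Qed.

(** All the arguments of all the terms lie in one compact set, the union of
    three convergent sequences with their limits, where the convergence is
    uniform. *)
Lemma cvg_irq_diff_seq (x_ u_ v_ : nat -> X) (x u v : X) :
  x_ @ \oo --> x -> u_ @ \oo --> u -> v_ @ \oo --> v ->
  irq_diff Q k (x_ k) (u_ k) (v_ k) @[k --> \oo] --> irq_diff_lim Q x u v.
Proof.
move=> xx uu vv.
pose ran (a : nat -> X) p := range a `|` [set p].
pose K := ran x_ x `|` ran u_ u `|` ran v_ v.
have cK : compact K.
  apply: compactU; [apply: compactU|]; exact: compact_cvg_range.
have [_ _ _ _ [[_ /(_ K cK) unifQ] _]] := uQ.
have KK : (K `*` K `*` K) (x, u, v).
  by split; [split; left; [left|right]|right]; right.
have joint := uniform_limit_joint irq_diff_continuous unifQ KK.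
suff sub : (n, (x_ n, u_ n, v_ n)) @[n --> \oo] -->
    filter_prod \oo (within (K `*` K `*` K) (nbhs (x, u, v))).
  exact: (cvg_comp _ _ sub joint).
apply: (@cvg_pair _ _ _ \oo \oo (within _ (nbhs (x, u, v)))).
  exact: cvg_id.
move=> A wA; have [N _ NA] := cvg_triple xx uu vv wA.
exists N => // n Nn; apply: (NA n Nn).
by split; [split; left; [left|right]|right]; left; exists n.
Qed.

Lemma cvg_irq_diff x u v :
  irq_diff Q k x u v @[k --> \oo] --> irq_diff_lim Q x u v.
Proof. by have [_ _ _ _ [[]]] := uQ. Qed.

Lemma cvg_irq_sum x u v :
  irq_sum Q k x u v @[k --> \oo] --> irq_sum_lim Q x u v.
Proof. by have [_ _ _ _ [_ []]] := uQ. Qed.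

Lemma cvg_circ_n x u : circ_n Q n x u @[n --> \oo] --> x.
Proof.
have [_ _ _ cQ _] := uQ.
move=> A; rewrite nbhsE => -[U [oU Ux] UA].
have [N NU] := cQ x [set u] U (@compact_set1 _ _) oU Ux.
by exists N => // n Nn; apply: UA; exact: NU.
Qed.

Lemma irq_diff_limP x u v l : irq_diff Q k x u v @[k --> \oo] --> l ->
  irq_diff_lim Q x u v = l.
Proof. exact: irq_diff_lim_unique hausX. Qed.

Lemma irq_diff_lim_left x v : irq_diff_lim Q x x v = v.
Proof.
apply: irq_diff_limP; under eq_fun do rewrite /irq_diff circ_nxx// circ_nK//.
exact: cvg_cst.
Qed.

Lemma irq_diff_lim_right x u : irq_diff_lim Q x u u = x.
Proof.
apply: irq_diff_limP; under eq_fun do rewrite /irq_diff bull_nxx//.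
exact: cvg_circ_n.
Qed.

Lemma irq_diff_lim_morph (h : X -> X) x u v : continuous h ->
  {morph h : y z / circ Q y z} ->
  h (irq_diff_lim Q x u v) = irq_diff_lim Q (h x) (h u) (h v).
Proof.
move=> hc hD; apply/esym/irq_diff_limP.
under eq_fun do rewrite -(irq_diff_morph irqQ _ hD).
by apply: continuous_cvg; [exact: hc|exact: cvg_irq_diff].
Qed.

Hypothesis distrQ : irq_distributive Q.

(** Distributivity identifies the sum with a difference at each finite level. *)
Lemma irq_sum_limE x u v : irq_sum_lim Q x u v = irq_diff_lim Q u x v.
Proof.
apply/esym/irq_diff_limP; under eq_fun do rewrite -irq_sumE//.
exact: cvg_irq_sum.
Qed.

Lemma irq_diff_lim_chain x y w z :
  irq_diff_lim Q x y (irq_diff_lim Q y w z) = irq_diff_lim Q x w z.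
Proof.
have : irq_diff Q k x y (irq_diff Q k y w z) @[k --> \oo] -->
    irq_diff_lim Q x y (irq_diff_lim Q y w z).
  by apply: cvg_irq_diff_seq (cvg_cst _) (cvg_cst _) _; exact: cvg_irq_diff.
under eq_fun do rewrite irq_diff_chain//.
by move/irq_diff_limP.
Qed.

(** Limit of [irq_sumA], read in terms of differences: the displaced base point
    [circ_n Q k y x] converges to [y]. *)
Lemma irq_diff_lim_assoc x y z w :
  irq_diff_lim Q x y (irq_diff_lim Q z y w) =
  irq_diff_lim Q (irq_diff_lim Q x y z) y w.
Proof.
have A : irq_diff Q k x y (irq_diff Q k z (circ_n Q k y x) w) @[k --> \oo] -->
    irq_diff_lim Q x y (irq_diff_lim Q z y w).
  apply: cvg_irq_diff_seq (cvg_cst _) (cvg_cst _) _.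
  exact: cvg_irq_diff_seq (cvg_cst _) (@cvg_circ_n y x) (cvg_cst _).
have B : irq_diff Q k (irq_diff Q k x y z) y w @[k --> \oo] -->
    irq_diff_lim Q (irq_diff_lim Q x y z) y w.
  exact: cvg_irq_diff_seq (@cvg_irq_diff _ _ _) (cvg_cst _) (cvg_cst _).
apply: (cvg_unique hausX) A _.
rewrite /=; under eq_fun do rewrite -!irq_sumE// irq_sumA// !irq_sumE//.
exact: B.
Qed.

(** The key to the formula for [circ] in terms of the group: the left-hand side
    is the limit of [circ Q (circ_n Q k x e) y], which is the difference on the
    right-hand side at level [k], by [irq_diff_circ]. *)
Lemma circ_irq_diff_lim e x y :
  circ Q x y = irq_diff_lim Q x (circ Q e x) (circ Q e y).
Proof.
apply/esym/irq_diff_limP; under eq_fun do rewrite irq_diff_circ//.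
have [_ _ [circC _] _ _] := uQ.
exact: (cvg_op2 circC (@cvg_circ_n x e) (cvg_cst _)).
Qed.

Section BasedGroup.
Variable e : X.
Local Notation mul x y := (irq_diff_lim Q x e y).
Local Notation inv x := (irq_diff_lim Q e x e).

Lemma irq_diff_lim_group : is_group (fun x y => mul x y) e (fun x => inv x).
Proof.
apply: heap_group; [exact: irq_diff_lim_left|exact: irq_diff_lim_right|
  exact: irq_diff_lim_chain|exact: irq_diff_lim_assoc].
Qed.

Lemma irq_diff_lim_div y z : mul (inv y) z = irq_diff_lim Q e y z.
Proof.
apply: (@heap_div _ (irq_diff_lim Q)).
- exact: irq_diff_lim_left.
- exact: irq_diff_lim_right.
- exact: irq_diff_lim_chain.
- exact: irq_diff_lim_assoc.
Qed.

Lemma irq_diff_lim_mul x y z : irq_diff_lim Q x y z = mul (mul x (inv y)) z.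
Proof.
by rewrite -irq_diff_lim_assoc irq_diff_lim_div irq_diff_lim_chain.
Qed.

Lemma circ_morph : {morph circ Q e : x y / mul x y}.
Proof.
move=> x y; rewrite irq_diff_lim_morph.
- by have [_ _ -> _] := irqQ e e.
- exact: circ_continuousr.
- exact: distrQ.
Qed.

Lemma circ_mul x y : circ Q x y = mul x (circ Q e (mul (inv x) y)).
Proof.
rewrite irq_diff_lim_div irq_diff_lim_morph.
- by have [_ _ -> _] := irqQ e e; rewrite irq_diff_lim_chain -circ_irq_diff_lim.
- exact: circ_continuousr.
- exact: distrQ.
Qed.

End BasedGroup.
End UniformIrq.

(** * The irq of a contractible group *)

Lemma group_aut_eq (G : Type) (A B : group_aut G) :
  gmul A =2 gmul B -> ginv A =1 ginv B -> gaut A =1 gaut B ->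
  gautV A =1 gautV B -> A = B.
Proof.
case: A B => m i a a' [m' i' b b'] /= mm' ii' ab ab'.
by congr GroupAut; apply/funext => x //; exact/funext.
Qed.

Lemma iter_cancel (T : Type) (f g : T -> T) n :
  cancel f g -> cancel (iter n f) (iter n g).
Proof. by move=> fK x; elim: n => [//|n IH]; rewrite iterSr /= fK. Qed.

Section GroupIrq.
Context {G : Type} {e : G} {A : group_aut G}.
Hypothesis groupA : is_group (gmul A) e (ginv A).
Hypothesis autM : {morph gaut A : x y / gmul A x y}.
Hypothesis autK : cancel (gaut A) (gautV A).
Hypothesis autVK : cancel (gautV A) (gaut A).
Local Notation "x *% y" := (gmul A x y) (at level 40, left associativity).
Local Notation "x ^i" := (ginv A x) (at level 2, format "x ^i").
Local Notation Q := (irq_of_group A).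

Lemma grp_mulA : associative (gmul A). Proof. by case: groupA. Qed.
Lemma grp_mul1 : left_id e (gmul A). Proof. by case: groupA. Qed.
Lemma grp_mulx1 : right_id e (gmul A). Proof. by case: groupA. Qed.
Lemma grp_mulV : left_inverse e (ginv A) (gmul A). Proof. by case: groupA. Qed.
Lemma grp_mulxV : right_inverse e (ginv A) (gmul A).
Proof. by case: groupA. Qed.

Lemma grp_mulK x y : x^i *% (x *% y) = y.
Proof. by rewrite grp_mulA grp_mulV grp_mul1. Qed.

Lemma grp_mulVK x y : x *% (x^i *% y) = y.
Proof. by rewrite grp_mulA grp_mulxV grp_mul1. Qed.

Lemma grp_mulI x : injective (gmul A x).
Proof. exact: can_inj (grp_mulK x). Qed.

Lemma grp_inv1 : e^i = e.
Proof. by rewrite -[LHS]grp_mul1 grp_mulxV. Qed.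

Lemma grp_divKl x a b : (x *% a)^i *% (x *% b) = a^i *% b.
Proof.
by apply: (@grp_mulI (x *% a)); rewrite grp_mulVK -grp_mulA grp_mulVK.
Qed.

Lemma grp_aut1 : gaut A e = e.
Proof. by apply: (@grp_mulI (gaut A e)); rewrite -autM grp_mul1 grp_mulx1. Qed.

Lemma grp_aut_div a b : (gaut A a)^i *% gaut A b = gaut A (a^i *% b).
Proof. by apply: (@grp_mulI (gaut A a)); rewrite grp_mulVK -autM grp_mulVK. Qed.

Lemma iter_autM n : {morph iter n (gaut A) : x y / x *% y}.
Proof. by move=> x y; elim: n => [//|n IH] /=; rewrite IH autM. Qed.

Lemma irq_of_groupP : is_irq Q.
Proof.
have autV1 : gautV A e = e by rewrite -[in LHS]grp_aut1 autK.
move=> x y; split=> /=; rewrite ?grp_mulK ?autVK ?autK ?grp_mulVK//.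
  by rewrite grp_mulV grp_aut1 grp_mulx1.
by rewrite grp_mulV autV1 grp_mulx1.
Qed.

Lemma irq_of_group_distr : irq_distributive Q.
Proof.
move=> x y z /=; rewrite grp_divKl grp_aut_div grp_divKl.
by rewrite [_^i *% (y *% _)]grp_mulA autM grp_mulA.
Qed.

Lemma circ_nG n x u : circ_n Q n x u = x *% iter n (gaut A) (x^i *% u).
Proof.
by elim: n => [|n IH] /=; rewrite ?grp_mulVK// IH grp_mulK.
Qed.

Lemma bull_nG n x u : bull_n Q n x u = x *% iter n (gautV A) (x^i *% u).
Proof.
by elim: n => [|n IH] /=; rewrite ?grp_mulVK// IH grp_mulK.
Qed.

(** When [gaut A] is contracting, the middle factor tends to [e], and the
    difference to the heap operation x u^-1 v of the group. *)
Lemma irq_diffG k x u v :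
  irq_diff Q k x u v = x *% iter k (gaut A) (x^i *% u) *% (u^i *% v).
Proof.
rewrite (irq_diffE irq_of_groupP irq_of_group_distr) circ_nG bull_nG.
by rewrite grp_mulA iter_autM (iter_cancel k autVK) grp_mulA.
Qed.

End GroupIrq.

Section ContractibleGroup.
Context {G : topologicalType} {e : G} {A : group_aut G}.
Hypothesis contrA : contractible_group e A.
Local Notation "x *% y" := (gmul A x y) (at level 40, left associativity).
Local Notation "x ^i" := (ginv A x) (at level 2, format "x ^i").
Local Notation Q := (irq_of_group A).

Let groupA : is_group (gmul A) e (ginv A). Proof. by case: contrA. Qed.
Let mulC : continuous (fun p : G * G => p.1 *% p.2).
Proof. by case: contrA => _ []. Qed.
Let invC : continuous (ginv A). Proof. by case: contrA => _ []. Qed.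
Let autM : {morph gaut A : x y / x *% y}. Proof. by case: contrA => _ _ []. Qed.
Let autK : cancel (gaut A) (gautV A). Proof. by case: contrA => _ _ []. Qed.
Let autVK : cancel (gautV A) (gaut A). Proof. by case: contrA => _ _ []. Qed.
Let autC : continuous (gaut A). Proof. by case: contrA => _ _ _ []. Qed.
Let autVC : continuous (gautV A). Proof. by case: contrA => _ _ _ []. Qed.
Let contr x : iter n (gaut A) x @[n --> \oo] --> e.
Proof. by case: contrA. Qed.

Lemma contractible_irq : is_irq Q.
Proof. exact: (irq_of_groupP groupA autM autK autVK). Qed.

Lemma contractible_distr : irq_distributive Q.
Proof. exact: (irq_of_group_distr groupA autM). Qed.

Lemma cvg_grp_div (I : Type) (F : set_system I) (f g : I -> G) x y
    {FF : Filter F} :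
  f i @[i --> F] --> x -> g i @[i --> F] --> y ->
  (f i)^i *% g i @[i --> F] --> x^i *% y.
Proof.
move=> fx gy; apply: (cvg_op2 mulC) gy.
by apply: continuous_cvg => //; exact: invC.
Qed.

Lemma circ_group_continuous : continuous (fun p : G * G => circ Q p.1 p.2).
Proof.
move=> [x u]; apply: (cvg_op2 mulC); first exact: cvg_fst.
apply: continuous_cvg; first exact: autC.
by apply: cvg_grp_div; [exact: cvg_fst|exact: cvg_snd].
Qed.

Lemma bull_group_continuous : continuous (fun p : G * G => bull Q p.1 p.2).
Proof.
move=> [x u]; apply: (cvg_op2 mulC); first exact: cvg_fst.
apply: continuous_cvg; first exact: autVC.
by apply: cvg_grp_div; [exact: cvg_fst|exact: cvg_snd].
Qed.

Lemma cvg_irq_diff_group x u v :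
  irq_diff Q k x u v @[k --> \oo] --> x *% (u^i *% v).
Proof.
under eq_fun do rewrite (irq_diffG groupA autM autK autVK).
apply: (cvg_op2 mulC) (cvg_cst _).
rewrite -[X in _ --> X](grp_mulx1 groupA).
by apply: (cvg_op2 mulC) (cvg_cst _) _; exact: contr.
Qed.

Lemma grp_heap_continuous :
  continuous (fun p : G * G * G => p.1.1 *% (p.1.2^i *% p.2)).
Proof.
move=> [[x u] v].
apply: (cvg_op2 mulC); first exact: cvg_triple1.
by apply: cvg_grp_div; [exact: cvg_triple2|exact: cvg_snd].
Qed.

Section LocallyCompact.
Hypothesis regG : regular_space G.
Hypothesis lcG : locally_compact [set: G].

(** The closed sets [C n] of the points whose orbit is in a small closed
    neighbourhood [closure U] of [e] from time [n] on cover the group, by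
    pointwise contraction; so one of them is a neighbourhood of some [w]. Its
    right translate by the inverse of [w] is a neighbourhood of [e], which all
    the iterates from the [n]-th on map into quotients of elements of [closure
    U]. *)
Lemma contraction_locally_uniform :
  iter q.1 (gaut A) q.2 @[q --> filter_prod \oo (nbhs e)] --> e.
Proof.
have itC n : continuous (iter n (gaut A)).
  elim: n => [|n IH] x; first exact: cvg_id.
  by apply: continuous_cvg; [exact: autC|exact: IH].
move=> O Oe.
have divC : p.1 *% p.2^i @[p --> (e, e)] --> e.
  rewrite -[X in _ --> X](grp_mulxV groupA e).
  apply: (cvg_op2 mulC) cvg_fst _.
  by apply: continuous_cvg; [exact: invC|exact: cvg_snd].
have [[U1 U2] [/= U1e U2e] UO] := divC O Oe.
have [U Ue clU] := regG (filterI U1e U2e).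
pose C n := [set w | forall k, (n <= k)%N -> closure U (iter k (gaut A) w)].
have clC n : closed (C n).
  have -> : C n = \bigcap_(k in [set k | (n <= k)%N])
      (iter k (gaut A) @^-1` closure U) by [].
  apply: closed_bigI => k _; apply: preimage_closed => [x _|].
    exact: itC.
  exact: closed_closure.
have covC : \bigcup_n C n = setT.
  apply/seteqP; split=> // w _.
  have [n _ nU] := contr w Ue.
  by exists n => // k nk; apply: subset_closure; exact: nU.
have [n [w Cw]] := locally_compact_baire e regG lcG clC covC.
have Cww := nbhs_singleton Cw.
have CV : nbhs e [set y | C n (y *% w)].
  have : y *% w @[y --> e] --> w.
    rewrite -[X in _ --> X](grp_mul1 groupA).
    exact: (cvg_op2 mulC cvg_id (cvg_cst _)).
  by apply.
exists ([set k | (n <= k)%N], [set y | C n (y *% w)]) => /=.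
  by split=> //; exact: nbhs_infty_ge.
move=> [k y] /= [nk Cy].
have [Uy _] := clU _ (Cy k nk); have [_ Uw] := clU _ (Cww k nk).
have := UO (_, _) (conj Uy Uw); rewrite /= (iter_autM autM).
by rewrite -(grp_mulA groupA) (grp_mulxV groupA) (grp_mulx1 groupA).
Qed.

(** Translation by a fixed [y] extends the local uniformity at [e] to [y]: write
    [y_ i] as [y *% (y^i *% y_ i)] and contract each factor. *)
Lemma cvg_contraction (I : Type) (F : set_system I) (n_ : I -> nat)
    (y_ : I -> G) (y : G) {FF : Filter F} :
  n_ i @[i --> F] --> \oo -> y_ i @[i --> F] --> y ->
  iter (n_ i) (gaut A) (y_ i) @[i --> F] --> e.
Proof.
move=> noo yy.
rewrite -[X in _ --> X](grp_mul1 groupA).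
under eq_fun do rewrite -[y_ _](grp_mulVK groupA y) (iter_autM autM).
apply: (cvg_op2 mulC); first exact: (cvg_comp _ _ noo (contr y)).
have dd : y^i *% y_ i @[i --> F] --> e.
  rewrite -[X in _ --> X](grp_mulV groupA y).
  exact: (cvg_grp_div (cvg_cst _) yy).
exact: (cvg_comp _ _ (cvg_pair noo dd) contraction_locally_uniform).
Qed.

Lemma cvg_irq_diff_group_joint (I : Type) (F : set_system I) (n_ : I -> nat)
    (x_ u_ v_ : I -> G) (x u v : G) {FF : Filter F} :
  n_ i @[i --> F] --> \oo -> x_ i @[i --> F] --> x ->
  u_ i @[i --> F] --> u -> v_ i @[i --> F] --> v ->
  irq_diff Q (n_ i) (x_ i) (u_ i) (v_ i) @[i --> F] --> x *% (u^i *% v).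
Proof.
move=> noo xx uu vv.
under eq_fun do rewrite (irq_diffG groupA autM autK autVK).
apply: (cvg_op2 mulC) (cvg_grp_div uu vv).
rewrite -[X in _ --> X](grp_mulx1 groupA).
exact: (cvg_op2 mulC xx (cvg_contraction noo (cvg_grp_div xx uu))).
Qed.

(** Joint convergence at each point of [K] is uniform on [K], by compactness. *)
Lemma contractible_compactly : forall (x : G) (K U : set G),
  compact K -> open U -> U x ->
  exists N, forall n, (N <= n)%N -> forall u, K u -> U (circ_n Q n x u).
Proof.
move=> x K U /compact_near_coveringP cK oU Ux.
suff [N _ NU] : \forall n \near \oo, K `<=` (fun u => U (circ_n Q n x u)).
  by exists N => n; exact: NU.
apply: (cK _ \oo (fun n u => U (circ_n Q n x u))) => u _.
have : circ_n Q p.2 x p.1 @[p --> filter_prod (nbhs u) \oo] --> x.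
  rewrite -[X in _ --> X](grp_mulx1 groupA).
  under eq_fun do rewrite (circ_nG groupA).
  apply: (cvg_op2 mulC) (cvg_cst _) _.
  exact: (cvg_contraction cvg_snd (cvg_grp_div (cvg_cst _) cvg_fst)).
by apply; exact: open_nbhs_nbhs.
Qed.

End LocallyCompact.
End ContractibleGroup.

Section UniformContractibleGroup.
Context {G : uniformType} {e : G} {A : group_aut G}.
Hypothesis contrA : contractible_group e A.
Hypothesis hausG : hausdorff_space G.
Local Notation Q := (irq_of_group A).
Let groupA : is_group (gmul A) e (ginv A). Proof. by case: contrA. Qed.

Lemma irq_diff_lim_irq_of_group x u v :
  irq_diff_lim Q x u v = gmul A x (gmul A (ginv A u) v).
Proof.
by apply: irq_diff_lim_unique => //; exact: (cvg_irq_diff_group contrA).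
Qed.

Lemma locally_compact_uniform_irq :
  locally_compact [set: G] -> uniform_irq Q.
Proof.
move=> lcG.
have irqQ := contractible_irq contrA.
have distrQ := contractible_distr contrA.
have joint := @cvg_irq_diff_group_joint _ _ _ contrA uniform_regular lcG.
have c1 (p : G * G * G) : q.2.1.1 @[q --> filter_prod \oo (nbhs p)] --> p.1.1.
  by move: p => [[x u] v]; exact: (cvg_comp _ _ cvg_snd (@cvg_triple1 _ x u v)).
have c2 (p : G * G * G) : q.2.1.2 @[q --> filter_prod \oo (nbhs p)] --> p.1.2.
  by move: p => [[x u] v]; exact: (cvg_comp _ _ cvg_snd (@cvg_triple2 _ x u v)).
have c3 (p : G * G * G) : q.2.2 @[q --> filter_prod \oo (nbhs p)] --> p.2.
  by move: p => [[x u] v]; exact: (cvg_comp _ _ cvg_snd cvg_snd).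
have heapC := grp_heap_continuous contrA.
split=> //.
- by split; [exact: (circ_group_continuous contrA)|
             exact: (bull_group_continuous contrA)].
- exact: (contractible_compactly contrA uniform_regular lcG).
split.
  apply: joint_compactly_uniform irq_diff_lim_irq_of_group heapC _ => p.
  by apply: joint; [exact: cvg_fst|exact: c1|exact: c2|exact: c3].
apply: (@joint_compactly_uniform _ _
  (fun x u v => gmul A u (gmul A (ginv A x) v))) => [x u v|[[x u] v]|p].
- apply: irq_sum_lim_unique => //.
  under eq_fun do rewrite irq_sumE//.
  exact: (cvg_irq_diff_group contrA).
- have := cvg_comp _ _ (cvg_triple (@cvg_triple2 _ x u v)
    (@cvg_triple1 _ x u v) cvg_snd) (heapC (u, x, v)).
  exact.
- under eq_fun do rewrite irq_sumE//.
  by apply: joint; [exact: cvg_fst|exact: c2|exact: c1|exact: c3].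
Qed.

End UniformContractibleGroup.

(** * The correspondence *)

(** The inverse of [irq_of_group], at a given base point. *)
Definition group_of_irq (G : uniformType) (e : G) (Q : irq_ops G) :
    group_aut G :=
  GroupAut (fun x y => irq_diff_lim Q x e y) (fun x => irq_diff_lim Q e x e)
           (circ Q e) (bull Q e).

(** In [irq_of_group A] the limit of differences is x u^-1 v, and [circ] and
    [bull] based at [e] are the automorphism and its inverse: the irq and [e]
    remember everything. *)
Lemma irq_of_groupK (G : uniformType) (e : G) (A : group_aut G) :
  contractible_group e A -> hausdorff_space G ->
  group_of_irq e (irq_of_group A) = A.
Proof.
move=> contrA hausG; have [groupA _ _ _ _] := contrA.
have limE := irq_diff_lim_irq_of_group contrA hausG.
have e1 := grp_inv1 groupA; have mul1 := grp_mul1 groupA.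
apply: group_aut_eq => [x y|x|x|x] /=.
- by rewrite limE e1 mul1.
- by rewrite limE mul1 (grp_mulx1 groupA).
- by rewrite e1 !mul1.
- by rewrite e1 !mul1.
Qed.

Section DistributiveUniformIrq.
Context {G : uniformType} {e : G} {Q : irq_ops G}.
Hypothesis dQ : distributive_uniform_irq Q.
Let uQ : uniform_irq Q. Proof. by case: dQ. Qed.
Let distrQ : irq_distributive Q. Proof. by case: dQ. Qed.
Let irqQ : is_irq Q. Proof. by case: uQ. Qed.
Let A := group_of_irq e Q.
Let groupA : is_group (gmul A) e (ginv A).
Proof. exact: irq_diff_lim_group. Qed.
Let autM : {morph gaut A : x y / gmul A x y}.
Proof. exact: circ_morph. Qed.
Let autK : cancel (gaut A) (gautV A).
Proof. by move=> x; have [] := irqQ e x. Qed.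
Let autVK : cancel (gautV A) (gaut A).
Proof. by move=> x; have [] := irqQ e x. Qed.

(** The formula for [circ] is [circ_mul]; both [bull] operations then invert
    the same bijections. *)
Lemma group_of_irqK : irq_of_group A = Q.
Proof.
have circE x y : circ (irq_of_group A) x y = circ Q x y.
  by rewrite [RHS](circ_mul uQ distrQ e).
have bullE x y : bull (irq_of_group A) x y = bull Q x y.
  apply: (can_inj (circ_nK irqQ 1 x)); rewrite /circ_n /= -[LHS]circE.
  have [-> _ _ _] := irq_of_groupP groupA autM autK autVK x y.
  by have [-> _ _ _] := irqQ x y.
exact: irq_ops_eq.
Qed.

Lemma contractible_group_of_irq :
  continuous (fun p : G * G * G => irq_diff_lim Q p.1.1 p.1.2 p.2) ->
  contractible_group e A.
Proof.
have [_ _ [circC bullC] _ _] := uQ.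
move=> limC; split=> //.
- split=> [[x y]|x] /=.
    have lim := limC (x, e, y).
    exact: (cvg_comp _ _ (cvg_triple cvg_fst (cvg_cst e) cvg_snd) lim).
  have lim := limC (e, x, e).
  exact: (cvg_comp _ _ (cvg_triple (cvg_cst e) cvg_id (cvg_cst e)) lim).
- by split=> x; [exact: (cvg_op2 circC (cvg_cst _) cvg_id)|
                 exact: (cvg_op2 bullC (cvg_cst _) cvg_id)].
- by move=> x; exact: cvg_circ_n.
Qed.

(** Each point of the cube has a neighbourhood that is the cube of a compact
    set, where the limit is uniform, hence continuous. *)
Lemma locally_compact_irq_diff_lim : locally_compact [set: G] ->
  continuous (fun p : G * G * G => irq_diff_lim Q p.1.1 p.1.2 p.2).
Proof.
move=> lcG [[x u] v].
have lc (y : G) : exists2 K, nbhs y K & compact K.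
  by have [K + []] := lcG y I; rewrite withinET; exists K.
have [Kx xK cKx] := lc x; have [Ku uK cKu] := lc u; have [Kv vK cKv] := lc v.
pose K := Kx `|` Ku `|` Kv.
have cK : compact K by apply: compactU => //; exact: compactU.
have nK : nbhs (x, u, v) (K `*` K `*` K).
  apply: nbhs_triple.
  - by apply: filterS xK => y; left; left.
  - by apply: filterS uK => y; left; right.
  - by apply: filterS vK => y; right.
have [_ _ _ _ [[_ /(_ K cK) unifQ] _]] := uQ.
have lim := uniform_limit_within (irq_diff_continuous uQ) unifQ
  (nbhs_singleton nK).
move=> B /lim; rewrite /fmap /= /within /=.
by move=> wB; apply: filterS2 nK wB => p Kp; exact.
Qed.

End DistributiveUniformIrq.

Theorem theorem6p1 :
  (* G(alpha) is distributive *)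
  (forall (G : topologicalType) (e : G) (A : group_aut G),
     contractible_group e A -> irq_distributive (irq_of_group A)) /\
  (* the group operation of a distributive uniform irq *)
  (forall (G : uniformType) (Q : irq_ops G),
     distributive_uniform_irq Q ->
     forall e : G, exists (mul : G -> G -> G) (inv : G -> G),
       [/\ is_group mul e inv,
           forall x y : G, mul x y = irq_sum_lim Q e x y,
           forall x y z : G,
             irq_diff_lim Q x y z = mul (mul x (inv y)) z &
           forall x y : G,
             circ Q x y = mul x (circ Q e (mul (inv x) y))]) /\
  (* the bijection, on an arbitrary pointed uniform space *)
  (forall (G : uniformType) (e : G),
     set_bij
       [set A : group_aut G |
         contractible_group e A /\ uniform_irq (irq_of_group A)]
       [set Q : irq_ops G |
         distributive_uniform_irq Q /\
         continuous
           (fun p : G * G * G => irq_diff_lim Q p.1.1 p.1.2 p.2)]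
       (@irq_of_group G)) /\
  (* the bijection, when the space is locally compact *)
  (forall (G : uniformType) (e : G),
     hausdorff_space G -> locally_compact [set: G] ->
     set_bij
       [set A : group_aut G | contractible_group e A]
       [set Q : irq_ops G | distributive_uniform_irq Q]
       (@irq_of_group G)).
Proof.
have bij (G : uniformType) (e : G) :
    set_bij [set A : group_aut G |
               contractible_group e A /\ uniform_irq (irq_of_group A)]
            [set Q : irq_ops G | distributive_uniform_irq Q /\
               continuous
                 (fun p : G * G * G => irq_diff_lim Q p.1.1 p.1.2 p.2)]
            (@irq_of_group G).
  split=> [A /= [contrA uA]|A B|Q /= [dQ limC]].
  - have [hausG _ _ _ _] := uA.
    split; first by split=> //; exact: (contractible_distr contrA).
    under eq_fun do rewrite (irq_diff_lim_irq_of_group contrA hausG).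
    exact: (grp_heap_continuous contrA).
  - rewrite !inE /= => -[contrA [hausG _ _ _ _]] [contrB _] AB.
    by rewrite -(irq_of_groupK contrA hausG) AB irq_of_groupK.
  - have QK := group_of_irqK (e := e) dQ.
    exists (group_of_irq e Q) => //; split; last by rewrite QK; case: dQ.
    exact: contractible_group_of_irq.
split; first by move=> G e A; exact: contractible_distr.
split.
  move=> G Q [uQ distrQ] e.
  exists (fun x y => irq_diff_lim Q x e y), (fun x => irq_diff_lim Q e x e).
  split=> [|x y|x y z|x y].
  - exact: irq_diff_lim_group.
  - by rewrite irq_sum_limE.
  - exact: irq_diff_lim_mul.
  - exact: circ_mul.
split=> // G e hausG lcG.
have -> : [set A : group_aut G | contractible_group e A] =
    [set A | contractible_group e A /\ uniform_irq (irq_of_group A)].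
  apply/seteqP; split=> A /= => [contrA|[]//]; split=> //.
  exact: (locally_compact_uniform_irq contrA hausG lcG).
have -> : [set Q : irq_ops G | distributive_uniform_irq Q] =
    [set Q | distributive_uniform_irq Q /\
       continuous (fun p : G * G * G => irq_diff_lim Q p.1.1 p.1.2 p.2)].
  apply/seteqP; split=> Q /= => [dQ|[]//].
  by split=> //; exact: locally_compact_irq_diff_lim.
exact: bij.
Qed.
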